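(* Let $n\ge 4$ and let $\sigma=(1\,2)(n-1\,\,n)\in S_n$. Then every associative (not necessarily unital) algebra $A$ over a field satisfying the identity $x_1\cdots x_n=x_{\sigma(1)}\cdots x_{\sigma(n)}$ is eventually commutative of degree $2n-3$, but such an algebra need not be eventually commutative of any degree less than $2n-3$.
   Context: An algebra $A$ satisfies an identity $x_1\cdots x_m=x_{\tau(1)}\cdots x_{\tau(m)}$ (with $\tau\in S_m$) if $a_1\cdots a_m=a_{\tau(1)}\cdots a_{\tau(m)}$ for all $a_1,\dots,a_m\in A$. The algebra $A$ is eventually commutative of degree $k$ if it satisfies $x_1\cdots x_k=x_{\tau(1)}\cdots x_{\tau(k)}$ for every $\tau\in S_k$. *)

(* Defs.v *)
From HB Require Import structures.
From mathcomp Require Import all_boot all_order all_algebra all_fingroup.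
Set Implicit Arguments. Unset Strict Implicit. Unset Printing Implicit Defensive.
Import GRing.Theory.
Local Open Scope ring_scope.

Definition is_assoc_algebra (K : fieldType) (A : lmodType K) (mul : A -> A -> A) : Prop :=
  [/\ (forall x y z, mul x (mul y z) = mul (mul x y) z),
      (forall x y z, mul (x + y) z = mul x z + mul y z),
      (forall x y z, mul x (y + z) = mul x y + mul x z),
      (forall (c : K) x y, mul (c *: x) y = c *: mul x y) &
      (forall (c : K) x y, mul x (c *: y) = c *: mul x y)].

(* The product x_1 ... x_m of a nonempty list (right-nested; by associativity
   any bracketing agrees).  The empty product is (arbitrarily) 0. *)
Fixpoint nprod (T : Type) (zero : T) (mul : T -> T -> T) (s : seq T) : T :=
  match s with
  | [::] => zero
  | [:: x] => x
  | x :: s' => mul x (nprod zero mul s')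
  end.

Definition satisfies_id (K : fieldType) (A : lmodType K) (mul : A -> A -> A)
    (m : nat) (tau : 'S_m) : Prop :=
  forall a : 'I_m -> A,
    nprod 0 mul [seq a i | i <- enum 'I_m] = nprod 0 mul [seq a (tau i) | i <- enum 'I_m].

Definition eventually_commutative (K : fieldType) (A : lmodType K) (mul : A -> A -> A)
    (k : nat) : Prop :=
  forall tau : 'S_k, satisfies_id mul tau.

(* sigma = (1 2)(n-1 n) in S_n, written 0-indexed on 'I_n as (0 1)(n-2 n-1). *)
Definition sigma (n : nat) : 'S_n :=
  match n return 'S_n with
  | 0 => 1%g
  | n'.+1 => (tperm (inord 0 : 'I_n'.+1) (inord 1) * tperm (inord n'.-1) (inord n'))%g
  end.

(* Main.v *)
(* Write n = N + 4.  Upper bound: in the identity a b w c d = b a w d c with w of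
   length N, taking for a (or b) a product of two factors turns the left
   transposition into a 3-cycle; three applications isolate the right
   transposition whenever three letters precede w, and symmetrically on the
   left.  Together with the identity this yields all adjacent transpositions of
   words of length 2N + 5 = 2n - 3.
   Lower bound: in a truncation of the algebra generated by X and Y with Y X = 0
   where X^i Y^j survives (i, j > 0) only for i, j <= N + 2, every
   commutator is a combination of such mixed monomials, hence is killed by right (and by
   left) multiplication by N + 2 further factors, so the identity holds; but
   X^i Y^j <> 0 = Y^j X^i for 1 <= i, j <= N + 2. *)
Require Import Defs.
From HB Require Import structures.
From mathcomp Require Import all_boot all_order all_algebra all_fingroup.
From mathcomp Require Import zify.
Set Implicit Arguments. Unset Strict Implicit. Unset Printing Implicit Defensive.
Import GRing.Theory.
Local Open Scope ring_scope.

(** * The action of [sigma] on words *)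

Lemma sigmaE (N : nat) (i : 'I_N.+4) :
  sigma N.+4 i = (if i == 0 :> nat then 1 else if i == 1 :> nat then 0
    else if i == N.+2 :> nat then N.+3 else if i == N.+3 :> nat then N.+2
    else i)%N :> nat.
Proof.
rewrite /sigma permM.
have E k : (k < N.+4)%N -> (inord k : 'I_N.+4) = k :> nat by exact: inordK.
have [E0 E1 E2 E3] : [/\ (inord 0 : 'I_N.+4) = 0%N :> nat,
  (inord 1 : 'I_N.+4) = 1%N :> nat, (inord N.+3.-1 : 'I_N.+4) = N.+2 :> nat
  & (inord N.+3 : 'I_N.+4) = N.+3 :> nat] by split; rewrite E //=; lia.
case: (tpermP _ _ i) => [->|->|/eqP + /eqP +];
  case: tpermP => [/(congr1 val)|/(congr1 val)|/eqP + /eqP +] /=;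
  rewrite -?val_eqE /= ?E0 ?E1 ?E2 ?E3; do ?case: eqP => ?; lia.
Qed.

Lemma map_nth_sigma (T : Type) (z a b c d : T) (w : seq T) :
  let N := size w in
  [seq nth z ([:: a, b & w] ++ [:: c; d]) (sigma N.+4 i) | i <- enum 'I_N.+4]
  = [:: b, a & w] ++ [:: d; c].
Proof.
move=> N; apply: (@eq_from_nth _ z).
  by rewrite size_map size_enum_ord /= size_cat /= addn2.
rewrite size_map size_enum_ord => i lti.
rewrite (nth_map (Ordinal lti)) ?size_enum_ord // sigmaE nth_enum_ord //.
case: i lti => [|[|i]] //= lti; rewrite !eqSS !nth_cat -/N.
have [ltiN|leNi] := ltnP i N; first by rewrite !ifF /= ?nth_cat ?ltiN //; lia.
have [->|->] : i = N \/ i = N.+1 by lia.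
  by rewrite eqxx /= nth_cat -/N ltnNge leqnSn /= subnn subSnn.
by rewrite ifF ?eqxx /= ?nth_cat -/N ?ltnn ?subnn ?subSnn //; lia.
Qed.

Lemma map_nth_enum_ord (T : Type) (z : T) (s : seq T) n :
  size s = n -> [seq nth z s i | i : 'I_n <- enum 'I_n] = s.
Proof.
by move=> <-; rewrite -[RHS](mkseq_nth z) /mkseq -val_enum_ord -map_comp.
Qed.

(** Insertion sort: [front] carries a letter leftwards by adjacent swaps. The prefix [u] holds the
    letters already placed, so every swap takes place in a word of length [k]. *)
Lemma perm_eq_adjacent_swaps (T : eqType) (U : Type) (P : seq T -> U) k :
  (forall u a b v, (size u + size v).+2 = k ->
     P (u ++ [:: a, b & v]) = P (u ++ [:: b, a & v])) ->
  forall s t, size s = k -> perm_eq s t -> P s = P t.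
Proof.
move=> swap.
have front x t1 : forall u t2, (size u + size t1 + size t2).+1 = k ->
    P (u ++ t1 ++ x :: t2) = P (u ++ x :: t1 ++ t2).
  elim: t1 => [//|y t1 IH] u t2 sk; rewrite /= in sk *.
  have {}IH := IH (rcons u y) t2; rewrite !cat_rcons size_rcons in IH.
  rewrite IH; last by lia.
  by apply: swap; rewrite size_cat; lia.
suff main s : forall u t, (size u + size s)%N = k -> perm_eq s t ->
    P (u ++ s) = P (u ++ t).
  by move=> s t sk; apply: (main s [::]).
elim: s => [|x s IHs] u t sk st.
  by move: st; rewrite perm_sym => /perm_nilP ->.
have xt : x \in t by rewrite -(perm_mem st) mem_head.
have szt := perm_size st.
move: szt st; case/splitPr: xt => t1 t2 szt.
rewrite perm_sym perm_catC /= perm_cons perm_catC perm_sym => st.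
move: szt; rewrite /= !size_cat /= => szt; rewrite /= in sk.
rewrite front; last by lia.
by rewrite -!(cat_rcons x) (IHs _ (t1 ++ t2)) ?size_rcons //; lia.
Qed.

(** * Upper bound: words in a semigroup satisfying the identity *)

Section Semigroup.
Variables (A : Type) (zero : A) (mul : A -> A -> A).
Local Notation P := (nprod zero mul).
Hypothesis mulA : forall x y z, mul x (mul y z) = mul (mul x y) z.

Lemma nprod_cons x s : ~~ nilp s -> P (x :: s) = mul x (P s).
Proof. by case: s. Qed.

Lemma nprod_cat s t : ~~ nilp s -> ~~ nilp t -> P (s ++ t) = mul (P s) (P t).
Proof.
move=> + t0; elim: s => [//|x [|y s] IHs] _; first exact: nprod_cons.
by rewrite cat_cons nprod_cons // IHs //= mulA.
Qed.

Lemma nprod_congr u s t v : P s = P t -> ~~ nilp s -> ~~ nilp t ->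
  P (u ++ s ++ v) = P (u ++ t ++ v).
Proof.
move=> E s0 t0.
(* Empty contexts are treated apart: [P [::]] is [zero], not a unit. *)
have {E} : P (s ++ v) = P (t ++ v).
  by case: v => [|x v]; rewrite ?cats0 // !nprod_cat // E.
case: u => [//|x u] E; rewrite !(@nprod_cat (x :: u)) ?E //.
  by case: (t) t0.
by case: (s) s0.
Qed.

Variable N : nat.
Hypothesis idA : forall a b c d w, size w = N ->
  P ([:: a, b & w] ++ [:: c; d]) = P ([:: b, a & w] ++ [:: d; c]).

Lemma swap_right e1 e2 e3 c d w : size w = N ->
  P ([:: e1, e2, e3 & w] ++ [:: c; d]) = P ([:: e1, e2, e3 & w] ++ [:: d; c]).
Proof.
move=> sw.
have rot x y z c' d' : P ([:: x, y, z & w] ++ [:: c'; d']) =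
    P ([:: z, x, y & w] ++ [:: d'; c']).
  have E := idA (mul x y) z c' d' sw.
  have w0 : ~~ nilp (w ++ [:: d'; c']) by case: (w).
  have w1 : ~~ nilp (w ++ [:: c'; d']) by case: (w).
  by move: E; rewrite !cat_cons !nprod_cons // -!mulA.
(* The cube of the 3-cycle is trivial, while three swaps of the last two letters amount to one. *)
by rewrite rot rot rot.
Qed.

Lemma swap_left a b e1 e2 e3 w : size w = N ->
  P ([:: a, b & w] ++ [:: e1; e2; e3]) = P ([:: b, a & w] ++ [:: e1; e2; e3]).
Proof.
move=> sw.
have rot x y z a' b' : P ([:: a', b' & w] ++ [:: x; y; z]) =
    P ([:: b', a' & w] ++ [:: y; z; x]).
  have := idA a' b' x (mul y z) sw.
  by rewrite !(@nprod_cat (_ :: _)) //= -!mulA.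
by rewrite rot rot rot.
Qed.

Lemma split_size (T : Type) (s : seq T) i : (i <= size s)%N ->
  exists s1 s2, s = s1 ++ s2 /\ size s1 = i.
Proof.
by move=> lei; exists (take i s), (drop i s); rewrite cat_take_drop size_takel.
Qed.

Lemma swap_right_in u v e1 e2 e3 c d w : size w = N ->
  P (u ++ [:: e1, e2, e3 & w] ++ [:: c, d & v]) =
  P (u ++ [:: e1, e2, e3 & w] ++ [:: d, c & v]).
Proof.
move=> sw; have := nprod_congr u v (swap_right e1 e2 e3 c d sw) isT isT.
by rewrite -!catA.
Qed.

Lemma swap_left_in u v a b e1 e2 e3 w : size w = N ->
  P (u ++ [:: a, b & w] ++ [:: e1, e2, e3 & v]) =
  P (u ++ [:: b, a & w] ++ [:: e1, e2, e3 & v]).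
Proof.
move=> sw; have := nprod_congr u v (swap_left a b e1 e2 e3 sw) isT isT.
by rewrite -!catA.
Qed.

Lemma swap_both_in u v a b c d w : size w = N ->
  P (u ++ [:: a, b & w] ++ [:: c, d & v]) =
  P (u ++ [:: b, a & w] ++ [:: d, c & v]).
Proof.
move=> sw; have := nprod_congr u v (idA a b c d sw) isT isT.
by rewrite -!catA.
Qed.

Lemma nprod_swap u a b v : (size u + size v = 2 * N + 3)%N ->
  P (u ++ [:: a, b & v]) = P (u ++ [:: b, a & v]).
Proof.
move=> suv; have [leu|ltu] := leqP (size u) N.
  (* At least N + 3 letters follow [a b]: room for [w] and three more. *)
  have [w [s [Ev sw]]] : exists w s, v = w ++ s /\ size w = N.
    by apply: split_size; lia.
  move: suv; rewrite {v}Ev size_cat; case: s => [|e1 [|e2 [|e3 s]]] /=; try lia.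
  by move=> _; apply: swap_left_in.
(* With N + 1 letters before and N + 2 after, swap both pairs, then undo the swap of [c d] using
   [e], [b], [a] as the three letters before [w]. *)
have [leu|{}ltu] := leqP (size u) N.+1.
  have [w [s [Ev sw]]] : exists w s, v = w ++ s /\ size w = N.
    by apply: split_size; lia.
  case/lastP: u => [|u e] in suv leu ltu *; first by [].
  move: suv leu; rewrite {v}Ev size_cat size_rcons.
  case: s => [|c [|d s]] /=; try lia.
  move=> _ _; rewrite (swap_both_in _ _ a b c d sw) -cats1 -!catA.
  exact: (swap_right_in u s e b a d c sw).
(* Here [w] is the block just before [a b]. If a letter [e] follows, swap both pairs and undo the
   swap of [e2 e3] using [b], [a], [e]; otherwise at least three letters precede [w]. *)
have [s [w [Eu ss]]] : exists s w, u = s ++ w /\ size s = (size u - N)%N.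
  by apply: split_size; lia.
have := congr1 size Eu; rewrite size_cat => su.
have sw : size w = N by lia.
have {}ss : (size s + size v = N + 3)%N by lia.
have {su suv} ltsu : (1 < size s)%N by lia.
rewrite {ltu u}Eu -catA.
case/lastP: s => [//|s e3] in ss ltsu *; case/lastP: s => [//|s e2] in ss ltsu *.
rewrite -!cats1 -!catA; case: v => [|e v] in ss *; last first.
  apply: (etrans (swap_both_in s (e :: v) e2 e3 a b sw)).
  exact: (swap_left_in s v e3 e2 b a e sw).
case/lastP: s => [|s e1] in ss ltsu *; first by rewrite /= in ss; lia.
rewrite -!cats1 -!catA.
exact: swap_right_in.
Qed.

End Semigroup.

(** * Identities indexed by permutations, restated for words *)

Section IdentityOnLists.
Variables (K : fieldType) (A : lmodType K) (mul : A -> A -> A).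
Local Notation P := (nprod 0 mul).

Lemma satisfies_sigmaP N :
  satisfies_id mul (sigma N.+4) <->
  forall a b c d w, size w = N ->
    P ([:: a, b & w] ++ [:: c; d]) = P ([:: b, a & w] ++ [:: d; c]).
Proof.
split=> [idA a b c d w sw | idA f].
  case: _ / sw in idA *.
  have := idA (fun i => nth 0 ([:: a, b & w] ++ [:: c; d]) i).
  by rewrite map_nth_enum_ord ?map_nth_sigma //= size_cat addn2.
have: size [seq f i | i : 'I_N.+4 <- enum 'I_N.+4] = N.+4.
  by rewrite size_map size_enum_ord.
have fE i : f i = nth 0 [seq f i | i : 'I_N.+4 <- enum 'I_N.+4] i.
  by rewrite (nth_map i) ?size_enum_ord ?nth_ord_enum.
case Es: [seq f i | i <- _] fE => [|a [|b s]] //= fE [].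
case/lastP: s Es fE => [|s d] //; case/lastP: s => [|w c] //.
rewrite -!cats1 -catA /= => Es fE; rewrite size_cat /= addn2 => -[sw].
rewrite (_ : map _ _ = [:: b, a & w] ++ [:: d; c]); first exact: idA.
case: _ / sw in f Es fE *; rewrite -(map_nth_sigma 0 a b c d w).
by apply: eq_map => i; rewrite fE.
Qed.

Lemma eventually_commutativeP k :
  eventually_commutative mul k <->
  forall s t, size s = k -> perm_eq s t -> P s = P t.
Proof.
split=> [com s t ss pst | com tau a].
  rewrite perm_sym in pst.
  have /(tuple_permP (s := t) (t := Tuple (introT eqP ss)))[p ->] := pst.
  have := com p (tnth (Tuple (introT eqP ss))).
  by rewrite map_tnth_enum.
apply: com; first by rewrite size_map size_enum_ord.
rewrite perm_sym (map_comp a tau); apply/perm_map/uniq_perm.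
- by rewrite map_inj_uniq ?enum_uniq //; apply: perm_inj.
- exact: enum_uniq.
- by move=> i; rewrite -[i](permKV tau) (mem_map perm_inj) !mem_enum.
Qed.

End IdentityOnLists.

(** * Lower bound: the truncated algebra with Y X = 0 *)

Section CounterExample.
Variables (K : fieldType) (N : nat).
Local Notation M := 'M[K]_N.+2.

Definition shift_mx : M := \matrix_(i, j) (j == i.+1 :> nat)%:R.

Lemma shift_mxX k : shift_mx ^+ k = \matrix_(i, j) (j == (i + k)%N :> nat)%:R.
Proof.
elim: k => [|k IHk]; apply/matrixP=> i j; rewrite !mxE.
  by rewrite addn0 eq_sym.
rewrite exprSr IHk mxE; under eq_bigr do rewrite !mxE -natrM mulnb.
have [lt_ik|le_ik] := ltnP (i + k) N.+2.
  rewrite (bigD1 (Ordinal lt_ik)) //= eqxx addnS big1 ?addr0 // => l.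
  by rewrite -val_eqE /= => /negPf->.
rewrite big1 => [|l _]; last by rewrite ltn_eqF // (leq_trans (ltn_ord l)).
by rewrite ltn_eqF // (leq_trans (ltn_ord j)) // addnS leqW.
Qed.

Lemma shift_mx_nilp : shift_mx ^+ N.+2 = 0.
Proof.
apply/matrixP=> i j; rewrite shift_mxX !mxE ltn_eqF //.
by rewrite (leq_trans (ltn_ord j)) // leq_addl.
Qed.

Lemma shift_mx_top : shift_mx ^+ N.+1 = delta_mx ord0 ord_max.
Proof.
apply/matrixP=> i j; rewrite shift_mxX !mxE -!val_eqE /=.
have := ltn_ord i; have := ltn_ord j => ltj lti.
by congr (nat_of_bool _)%:R; lia.
Qed.

(** [shift_mx ^+ i * link_mx * shift_mx ^+ j] is the matrix unit at (N + 1 - i, j) for i, j <= N +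
    1, so matrix units encode the surviving mixed monomials. *)
Definition link_mx : M := delta_mx ord_max ord0.

Lemma shift_link_shift_neq0 i j : (i <= N.+1)%N -> (j <= N.+1)%N ->
  shift_mx ^+ i * link_mx * shift_mx ^+ j != 0.
Proof.
move=> lei lej; apply/eqP=> E.
(* Multiplying by complementary powers reduces to the extreme exponents. *)
have : shift_mx ^+ N.+1 * link_mx * shift_mx ^+ N.+1 = 0.
  rewrite (_ : _ * _ * _ = shift_mx ^+ (N.+1 - i) *
    (shift_mx ^+ i * link_mx * shift_mx ^+ j) * shift_mx ^+ (N.+1 - j)).
    by rewrite E mulr0 mul0r.
  by rewrite !mulrA -exprD subnK // -!mulrA -exprD subnKC.
rewrite shift_mx_top /link_mx -!mulmxE !mul_delta_mx => /matrixP/(_ ord0 ord_max).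
by rewrite !mxE !eqxx => /eqP; rewrite oner_eq0.
Qed.

Local Notation phi := (horner_mx shift_mx).

(* [(p, q, m)] stands for [X p(X) + Y q(Y) + X m Y], where [Y X = 0] and [m] is
   a matrix on which [X] and [Y] act by left and right multiplication by
   [shift_mx]; in particular [X Y] is [X link_mx Y]. *)
Definition split_alg : lmodType K := ({poly K} * {poly K} * M)%type.

(** The matrix summands come from X p · Y q', X p · X m' Y and X m Y · Y q'; the remaining mixed
    products contain Y X. *)
Definition split_mul (u v : split_alg) : split_alg :=
  ('X * u.1.1 * v.1.1, 'X * u.1.2 * v.1.2,
   phi u.1.1 * link_mx * phi v.1.2 + phi ('X * u.1.1) * v.2 + u.2 * phi ('X * v.1.2)).

Lemma split_alg_eq (u v : split_alg) :
  u.1.1 = v.1.1 -> u.1.2 = v.1.2 -> u.2 = v.2 -> u = v.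
Proof. by case: u v => [[? ?] ?] [[? ?] ?] /= -> -> ->. Qed.

Lemma split_mul_assoc_algebra : is_assoc_algebra split_mul.
Proof.
have phiJ (m : M) p : m * phi p * shift_mx = m * shift_mx * phi p.
  by rewrite -!mulrA -{2 3}(horner_mx_X shift_mx) -!rmorphM mulrC.
have add3 (a b c d e f : M) : a + b + (c + d) + (e + f) = a + c + e + (b + d + f).
  by rewrite (addrACA a b c d) (addrACA (a + c) (b + d) e f).
split=> [x y z|x y z|x y z|c x y|c x y]; apply: split_alg_eq => /=.
- by rewrite !mulrA [_ * 'X]mulrC !mulrA.
- by rewrite !mulrA [_ * 'X]mulrC !mulrA.
- rewrite !rmorphM /= horner_mx_X !mulrDl !mulrDr !mulrA !phiJ !addrA.
  by congr (_ + _ + _); rewrite -addrA addrC.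
- by rewrite mulrDr mulrDl.
- by rewrite mulrDr mulrDl.
- by rewrite mulrDr !rmorphD /= !mulrDl add3.
- by rewrite mulrDr.
- by rewrite mulrDr.
- by rewrite !mulrDr !rmorphD /= !mulrDr add3.
- by rewrite -scalerAr -scalerAl.
- by rewrite -scalerAr -scalerAl.
- by rewrite -scalerAr !linearZ /= -!scalerAl -!scalerDr.
- by rewrite -scalerAr.
- by rewrite -scalerAr.
- by rewrite -!scalerAr !linearZ /= -!scalerAr -!scalerDr.
Qed.

Local Notation P := (nprod 0 split_mul).

(** Each multiplication contributes one factor ['X]. *)
Lemma nprod_split_dvd s : exists p q : {poly K},
  (P s).1 = ('X^((size s).-1) * p, 'X^((size s).-1) * q).
Proof.
elim: s => [|u [|v s] [p [q IHs]]]; first by exists 0, 0; rewrite !mulr0.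
  by exists u.1.1, u.1.2; rewrite !mul1r; case: u => [[]].
exists (u.1.1 * p), (u.1.2 * q); rewrite nprod_cons // {1}/split_mul IHs /=.
by rewrite exprS; congr (_, _); rewrite -!mulrA; congr (_ * _); rewrite mulrCA.
Qed.

Lemma phi_high_deg p : phi ('X * ('X^(N.+1) * p)) = 0.
Proof.
by rewrite mulrA -exprS rmorphM rmorphXn /= horner_mx_X shift_mx_nilp mul0r.
Qed.

(** [u] and [v] differ by some X m Y, and [P s] raises its Y-degree by N + 2, where powers of
    [shift_mx] vanish. *)
Lemma split_mul_eql u v s : u.1 = v.1 -> size s = N.+2 ->
  split_mul u (P s) = split_mul v (P s).
Proof.
move=> uv ss; have [p [q E]] := nprod_split_dvd s; rewrite ss /= in E.
by rewrite /split_mul E uv /= phi_high_deg !mulr0.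
Qed.

Lemma split_mul_eqr u v s : u.1 = v.1 -> size s = N.+2 ->
  split_mul (P s) u = split_mul (P s) v.
Proof.
move=> uv ss; have [p [q E]] := nprod_split_dvd s; rewrite ss /= in E.
by rewrite /split_mul E uv /= phi_high_deg !mul0r.
Qed.

Lemma split_mulC1 u v : (split_mul u v).1 = (split_mul v u).1.
Proof. by rewrite /split_mul /= -!mulrA [u.1.1 * _]mulrC [u.1.2 * _]mulrC. Qed.

Lemma split_satisfies_sigma : satisfies_id split_mul (sigma N.+4).
Proof.
have [mulA _ _ _ _] := split_mul_assoc_algebra.
apply/satisfies_sigmaP => a b c d w sw.
have E x y c' d' : P ([:: x, y & w] ++ [:: c'; d']) =
    split_mul (split_mul x y) (P (w ++ [:: c'; d'])).
  by rewrite !cat_cons !nprod_cons ?mulA //; case: (w).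
have swcd c' d' : size (w ++ [:: c'; d']) = N.+2 by rewrite size_cat sw addn2.
(* First [w c d] absorbs the commutator of [a] and [b], then [b a w] absorbs that of [c] and [d]. *)
rewrite !E (split_mul_eql (split_mulC1 a b)) // -!E !nprod_cat //=.
apply: (split_mul_eqr (s := [:: b, a & w])); last by rewrite /= sw.
exact: split_mulC1.
Qed.

Definition gen_x : split_alg := (1, 0, 0).
Definition gen_y : split_alg := (0, 1, 0).

(** The exponent drops by one because the component p stands for X p(X). *)
Lemma nprod_nseq_x k : P (nseq k.+1 gen_x) = ('X^k, 0, 0).
Proof.
elim: k => [//|k IHk]; rewrite -[LHS]/(split_mul gen_x (P (nseq k.+1 gen_x))) IHk.
by rewrite /split_mul /= !mulr1 !mulr0 rmorph0 !mulr0 !addr0 -exprS.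
Qed.

Lemma nprod_nseq_y k : P (nseq k.+1 gen_y) = (0, 'X^k, 0).
Proof.
elim: k => [//|k IHk]; rewrite -[LHS]/(split_mul gen_y (P (nseq k.+1 gen_y))) IHk.
by rewrite /split_mul /= !mulr1 !mulr0 rmorph0 !mul0r !addr0 -exprS.
Qed.

Lemma split_not_commutative k : (2 <= k)%N -> (k < 2 * N.+4 - 3)%N ->
  ~ eventually_commutative split_mul k.
Proof.
have [mulA _ _ _ _] := split_mul_assoc_algebra.
move=> k2 kN /eventually_commutativeP com.
have [i [j [Ek lei lej]]] : exists i j, [/\ k = (i.+1 + j.+1)%N, i <= N.+1 & j <= N.+1]%N.
  (* Fill [i] greedily; the rest fits since k - 2 <= 2 (N + 1). *)
  by exists (minn k.-2 N.+1), (k.-2 - minn k.-2 N.+1)%N; split; lia.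
have := com (nseq i.+1 gen_x ++ nseq j.+1 gen_y) (nseq j.+1 gen_y ++ nseq i.+1 gen_x).
rewrite size_cat !size_nseq => /(_ (esym Ek)); rewrite perm_catC perm_refl => /(_ isT).
(* Compare matrix components: the product with Y first has component 0. *)
rewrite !nprod_cat // !nprod_nseq_x !nprod_nseq_y => /(congr1 snd)/eqP.
rewrite /split_mul /= !mulr0 !mul0r !rmorph0 !mul0r !addr0 !rmorphXn /= horner_mx_X.
exact/negP/shift_link_shift_neq0.
Qed.
End CounterExample.

(** Degrees 0 and 1 are left out of the second half: there the symmetric group is trivial and every
    algebra is eventually commutative. *)
Theorem theorem2p17 (n : nat) (hn : (4 <= n)%N) :
  (forall (K : fieldType) (A : lmodType K) (mul : A -> A -> A),
      is_assoc_algebra mul -> satisfies_id mul (sigma n) ->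
      eventually_commutative mul (2 * n - 3)) /\
  (forall K : fieldType, exists (A : lmodType K) (mul : A -> A -> A),
      [/\ is_assoc_algebra mul, satisfies_id mul (sigma n) &
          forall k : nat, (2 <= k)%N -> (k < 2 * n - 3)%N ->
            ~ eventually_commutative mul k]).
Proof.
case: n hn => [|[|[|[|N]]]] // _; split=> [K A mul [mulA _ _ _ _] | K].
  move=> /satisfies_sigmaP idA; apply/eventually_commutativeP.
  apply: perm_eq_adjacent_swaps => u a b v suv.
  by apply: (nprod_swap mulA idA); do 2 apply: succn_inj; rewrite suv; lia.
exists (split_alg K N), (@split_mul K N); split.
- exact: split_mul_assoc_algebra.
- exact: split_satisfies_sigma.
- exact: split_not_commutative.
Qed.
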